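(* Let $\mathbb{V}$ be an $n$-dimensional vector space ($n\ge 1$) over a finite field $\mathbb{F}$ with $q$ elements, with basis $\{\alpha_1,\ldots,\alpha_n\}$, and let $\Gamma(\mathbb{V})$ be its non-zero component graph with respect to this basis. Let $M$ be a maximal clique in $\Gamma(\mathbb{V})$. If $k$ is the least element of $S[M]$ and $k>n/2$, then $k=\lfloor n/2\rfloor+1$, $$M=\{\beta\in\Gamma(\mathbb{V}) : |S_\beta|\ge\lfloor n/2\rfloor+1\},$$ and $$|M|=\sum_{r=k}^{n}\binom{n}{r}(q-1)^r.$$
   Context: Let $\theta$ be the null vector of $\mathbb{V}$. Every $\mathbf{a}\in\mathbb{V}$ is written uniquely as $\mathbf{a}=a_1\alpha_1+\cdots+a_n\alpha_n$. The non-zero component graph $\Gamma(\mathbb{V})$ with respect to the basis $\{\alpha_1,\ldots,\alpha_n\}$ is the simple graph with vertex set $\mathbb{V}\setminus\{\theta\}$ in which two distinct vertices $\mathbf{a},\mathbf{b}$ are adjacent if and only if there is at least one $i$ such that the coefficients of $\alpha_i$ in $\mathbf{a}$ and in $\mathbf{b}$ are both non-zero; $\beta\in\Gamma(\mathbb{V})$ means that $\beta$ is a vertex. For a vertex $\beta$, the skeleton $S_\beta$ is the set of those $\alpha_i$ having non-zero coefficient in the expansion of $\beta$ in the basis. A clique is a set of pairwise adjacent vertices; a maximal clique is a clique that is maximal with respect to inclusion. For a maximal clique $M$, $S(M)=\{S_\beta : \beta\in M\}$ and $S[M]=\{|S_\beta| : S_\beta\in S(M)\}\subset\mathbb{N}$.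 *)

(* Defs.v *)
From mathcomp Require Import all_boot all_order all_algebra all_field.

Set Implicit Arguments.
Unset Strict Implicit.
Unset Printing Implicit Defensive.

Import Order.TTheory GRing.Theory Num.Theory.
Local Open Scope ring_scope.

Section NonzeroComponentGraph.

(* A space over a finite field is finite; [finvect_type V] is [V] itself,
   carrying both the vector space and the [finType] structure. *)
Variables (F : finFieldType) (V : vectType F) (n : nat).
Variable alpha : n.-tuple (finvect_type V).
Implicit Types (a b beta : finvect_type V) (M : {set finvect_type V}).

Definition nzc_vertices : {set finvect_type V} := [set a | a != 0].

(* [coord alpha i a] is the coefficient of [alpha_i] in [a] when [alpha] is a
   basis of the whole space. *)
Definition nzc_adj : rel (finvect_type V) := fun a b =>
  [&& a \in nzc_vertices, b \in nzc_vertices, a != b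
    & [exists i : 'I_n, (coord alpha i a != 0) && (coord alpha i b != 0)]].

Definition skeleton beta : {set finvect_type V} :=
  [set tnth alpha i | i : 'I_n & coord alpha i beta != 0].

Definition clique M : bool :=
  (M \subset nzc_vertices)
  && [forall a in M, forall b in M, (a != b) ==> nzc_adj a b].

Definition maximal_clique M : bool := maxset clique M.

Definition skeletons M : {set {set finvect_type V}} :=
  [set skeleton beta | beta in M].

(* Used only as a collection of natural numbers, through membership. *)
Definition skeleton_sizes M : seq nat :=
  [seq #|A| | A : {set finvect_type V} in skeletons M].

End NonzeroComponentGraph.

Definition is_least (s : seq nat) (k : nat) : Prop :=
  k \in s /\ (forall j, j \in s -> (k <= j)%N).

(* Main.v *)
Require Import Defs.
From mathcomp Require Import all_boot all_order all_algebra all_field.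

Set Implicit Arguments.
Unset Strict Implicit.
Unset Printing Implicit Defensive.

Import Order.TTheory GRing.Theory Num.Theory.
Local Open Scope ring_scope.

(** Two subsets of an [n]-element set whose sizes both exceed [n / 2] must meet,
    by counting ([setI_neq0_of_card]).  Skeletons behave like such subsets, so
    the vertices with skeleton of size at least [n %/ 2 + 1] form a clique
    ([clique_large]).  If the least skeleton size of [M] exceeds [n / 2], then [M]
    lies inside this clique, and the maximality of [M] forces equality.  Every
    size up to [n] is the size of a skeleton ([exists_card_csupport]), so the
    least one occurring is exactly [n %/ 2 + 1].

    For the cardinality, coordinates identify vectors with functions from the
    index set to the field ([coordf_bij]), and there are
    [(q - 1) ^ #|A|] functions with support exactly [A]
    ([card_exact_support]); grouping the supports [A] by size gives the
    binomial sum ([card_large_support]). *)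

(** * Finite sets and functions with prescribed support *)

Lemma setI_neq0_of_card (T : finType) (A B : {set T}) :
  (#|T| < #|A| + #|B|)%N -> A :&: B != set0.
Proof.
apply: contraTneq => AB0; rewrite -leqNgt -cardsUI AB0 cards0 addn0.
exact: max_card.
Qed.

(** The values on [A] range freely over the elements other than [y]. *)
Lemma card_exact_support (I T : finType) (y : T) (A : {set I}) :
  #|[set f : {ffun I -> T} | [set i | f i != y] == A]| = ((#|T| - 1) ^ #|A|)%N.
Proof.
rewrite subn1 -(cardC1 y) -(card_pffun_on y) -cardsE.
apply: eq_card => f; rewrite !inE; apply/eqP/pffun_onP => [<-|[sfA fA]].
  split; first by apply/subsetP=> i; rewrite !inE.
  by move=> _ /imageP[i ifA ->]; move: ifA; rewrite !inE.
apply/setP=> i; rewrite inE; apply/idP/idP => [fi|iA].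
  by apply: (subsetP sfA); rewrite inE.
by have := fA _ (image_f f iA); rewrite !inE.
Qed.

Lemma card_large_support (I T : finType) (y : T) (k : nat) :
  #|[set f : {ffun I -> T} | k <= #|[set i | f i != y]|]%N|
  = (\sum_(k <= r < #|I|.+1) 'C(#|I|, r) * (#|T| - 1) ^ r)%N.
Proof.
pose supp (f : {ffun I -> T}) := [set i | f i != y].
rewrite -sum1_card (partition_big supp (fun A => k <= #|A|)%N) /=; last first.
  by move=> f; rewrite inE.
transitivity (\sum_(A : {set I} | k <= #|A|) (#|T| - 1) ^ #|A|)%N.
  apply: eq_bigr => A kA; rewrite -(card_exact_support y) -sum1_card.
  apply: eq_bigl => f; rewrite !inE andbC; case: eqP => //= fA.
  by move: kA; rewrite -fA.
pose sz (A : {set I}) : 'I_#|I|.+1 := inord #|A|.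
have szE A : sz A = #|A| :> nat by rewrite inordK // ltnS max_card.
rewrite (partition_big sz (fun r => k <= r)%N) /=; last by move=> A; rewrite szE.
rewrite big_geq_mkord; apply: eq_bigr => r kr.
rewrite -card_draws -sum_nat_const; apply: eq_big => [A|A /andP[_ /eqP <-]].
  rewrite inE -val_eqE /= szE andbC.
  by case: (#|A| =P r) => //= ->; rewrite kr.
by rewrite szE.
Qed.

(** * Coordinate supports and skeletons *)

Section Coordinates.

Variables (F : finFieldType) (V : vectType F) (n : nat).
Variable alpha : n.-tuple (finvect_type V).
Hypothesis alpha_basis : basis_of fullv alpha.
Implicit Types (a b : finvect_type V).

Definition csupport a : {set 'I_n} := [set i | coord alpha i a != 0].

Definition coordf a : {ffun 'I_n -> F} := [ffun i => coord alpha i a].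

Lemma coordf_bij : bijective coordf.
Proof.
exists (fun f : {ffun 'I_n -> F} => \sum_(i < n) f i *: alpha`_i) => [a|f].
  rewrite [RHS](coord_basis alpha_basis (memvf a)).
  by apply: eq_bigr => i _; rewrite ffunE.
apply/ffunP=> i; rewrite ffunE coord_sum_free //.
exact: basis_free alpha_basis.
Qed.

(** The members of a basis are distinct, so skeletons can be measured on
    indices. *)
Lemma card_skeleton a : #|skeleton alpha a| = #|csupport a|.
Proof.
rewrite card_imset; last first.
  by apply/tuple_uniqP; apply: free_uniq; apply: basis_free alpha_basis.
by apply: eq_card => i; rewrite inE.
Qed.

Lemma csupport_neq0 a : (0 < #|csupport a|)%N -> a != 0.
Proof.
by case/card_gt0P=> i; rewrite inE; apply: contraNneq => ->; rewrite linear0.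
Qed.

Lemma card_large_csupport k :
  #|[set a | k <= #|csupport a|]%N|
  = (\sum_(k <= r < n.+1) 'C(n, r) * (#|F| - 1) ^ r)%N.
Proof.
have := card_large_support 'I_n (0 : F) k; rewrite card_ord => <-.
rewrite -(on_card_preimset (f := coordf)); last exact: onW_bij coordf_bij.
apply: eq_card => a; rewrite !inE; congr (k <= _)%N.
by apply: eq_card => i; rewrite !inE ffunE.
Qed.

Lemma exists_card_csupport m : (m <= n)%N -> exists a, #|csupport a| = m.
Proof.
move=> le_mn; have [g _ gK] := coordf_bij.
have [A /eqP cardA] : exists A : {set 'I_n}, #|A| == m.
  apply/existsP; rewrite -[X in (m <= X)%N]card_ord in le_mn.
  have : (0 < #|[set A : {set 'I_n} | #|A| == m]|)%N.
    by rewrite card_draws bin_gt0.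
  by case/card_gt0P=> A; rewrite inE => cardA; apply/existsP; exists A.
exists (g [ffun i => (i \in A)%:R]); rewrite -cardA; apply: eq_card => i.
have /ffunP/(_ i) := gK [ffun i => (i \in A)%:R]; rewrite !ffunE inE => ->.
by case: (i \in A); rewrite ?oner_eq0 ?eqxx.
Qed.

Lemma clique_large k : (n < k + k)%N ->
  clique alpha [set a in nzc_vertices V | k <= #|skeleton alpha a|]%N.
Proof.
move=> lt_nkk; apply/andP; split; first by apply/subsetP=> a; case/setIdP.
apply/'forall_in_forall_inP => a /setIdP[a0 ka] b /setIdP[b0 kb].
apply/implyP=> ab; rewrite /nzc_adj a0 b0 ab /=.
have : csupport a :&: csupport b != set0.
  apply: setI_neq0_of_card; rewrite card_ord (leq_trans lt_nkk) //.
  by rewrite -!card_skeleton leq_add.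
by case/set0Pn=> i; rewrite !inE => abi; apply/existsP; exists i.
Qed.

Lemma mem_skeleton_sizes (M : {set finvect_type V}) j :
  reflect (exists2 a, a \in M & j = #|skeleton alpha a|)
          (j \in skeleton_sizes alpha M).
Proof.
apply: (iffP imageP) => [[A /imsetP[a aM ->] ->]|[a aM ->]]; first by exists a.
by exists (skeleton alpha a) => //; apply: imset_f.
Qed.

End Coordinates.

(** * Maximal cliques with large skeletons *)

Theorem theorem4p2 (F : finFieldType) (q : nat) (hq : #|F| = q)
    (V : vectType F) (n : nat) (hn : (1 <= n)%N)
    (alpha : n.-tuple (finvect_type V))
    (halpha : basis_of fullv alpha)
    (M : {set finvect_type V}) (hM : maximal_clique alpha M)
    (k : nat) (hk : is_least (skeleton_sizes alpha M) k)
    (hkn : n%:R / 2%:R < k%:R :> rat) :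
  [/\ k = (n %/ 2).+1,
      M = [set beta in nzc_vertices V
            | ((n %/ 2).+1 <= #|skeleton alpha beta|)%N]
    & #|M| = (\sum_(k <= r < n.+1) 'C(n, r) * (q - 1) ^ r)%N ].
Proof.
have lt_hk : (n %/ 2 < k)%N.
  by move: hkn; rewrite ltr_pdivrMr ?ltr0n // -natrM ltr_nat ltn_divLR.
have lt_n : (n < (n %/ 2).+1 + (n %/ 2).+1)%N.
  by rewrite addnn -muln2 -ltn_divLR.
have [_ k_min] := hk.
have [/andP[M_vert _] M_max] := maxsetP hM.
have ME : M = [set beta in nzc_vertices V
                | ((n %/ 2).+1 <= #|skeleton alpha beta|)%N].
  apply/esym/M_max; first exact: clique_large.
  apply/subsetP=> a aM; rewrite inE (subsetP M_vert) //=.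
  by apply: leq_trans lt_hk (k_min _ _); apply/mem_skeleton_sizes; exists a.
have kE : k = (n %/ 2).+1.
  apply/eqP; rewrite eqn_leq lt_hk andbT.
  (* this size does not exceed [n] because [n] is positive *)
  have le_hn : ((n %/ 2).+1 <= n)%N by rewrite ltn_Pdiv.
  have [a ca] := exists_card_csupport halpha le_hn.
  apply: k_min; apply/mem_skeleton_sizes.
  exists a; last by rewrite card_skeleton.
  by rewrite ME !inE card_skeleton // ca leqnn andbT (csupport_neq0 (alpha := alpha)) ?ca.
split=> //; rewrite -hq -(card_large_csupport halpha) ME kE.
apply: eq_card => a; rewrite !inE card_skeleton //.
(* a nonempty support already rules out the zero vector *)
by apply: andb_idl => ka; apply/csupport_neq0/(leq_trans _ ka).
Qed.
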